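(* Let $\mathbb X,\mathbb Y$ be finite-dimensional Hilbert spaces, $\lambda>0$, $b\in\mathbb Y$. Let $f:\mathbb X\to\mathbb R\cup\{+\infty\}$ be proper, closed and convex, let $A:\mathbb X\to\mathbb Y$ be a surjective linear operator, let $\mathcal E=\{x\in\mathbb X:Ax=b\}$, and assume $\mathcal F:=\mathcal E\cap\operatorname{dom} f\neq\emptyset$. Then the following statements are equivalent: (i) $f$ and $\delta_{\mathcal E}$ satisfy the subdifferential sum rule at every $x\in\mathcal F$, i.e. $\partial(f+\delta_{\mathcal E})(x)=\partial f(x)+A^*\mathbb Y$ for all $x\in\mathcal F$; (ii) the problem $\min_{x\in\mathbb X}\{\lambda f(x)+\tfrac12\|x-z\|^2: Ax=b\}$ is dual-representable at every $z\in\mathbb X$.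
   Context: $\delta_{\mathcal E}$ is the indicator function of $\mathcal E$ ($0$ on $\mathcal E$, $+\infty$ elsewhere), $A^*$ is the adjoint of $A$, and $A^*\mathbb Y$ is its range, which equals the normal cone of $\mathcal E$ at each of its points. $\operatorname{Prox}_h(t)=\arg\min_x\{h(x)+\tfrac12\|x-t\|^2\}$. Subdifferential sum rule (SSR): for proper closed convex $f,g$, SSR holds at $x$ if $x\in\operatorname{dom} f\cap\operatorname{dom} g$ and $\partial(f+g)(x)=\partial f(x)+\partial g(x)$. The problem $\min_x\{\lambda f(x)+\tfrac12\|x-z\|^2: Ax=b\}$ is dual-representable at $z$ if there exists $y^*\in\mathbb Y$ such that $0\in A\,\operatorname{Prox}_{\lambda f}(z+A^*y^* )-b$ (equivalently, the problem and its Lagrangian dual both attain their optimal values, with zero duality gap). *)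

(* Defs.v *)
From HB Require Import structures.
From mathcomp Require Import all_boot all_order all_algebra.
From mathcomp Require Import all_classical all_reals all_analysis.

Set Implicit Arguments.
Unset Strict Implicit.
Unset Printing Implicit Defensive.

Import Order.TTheory GRing.Theory Num.Theory.
Import numFieldNormedType.Exports.

Local Open Scope classical_set_scope.
Local Open Scope ring_scope.

(* The norm, hence the topology, is the one induced by the inner product. *)
HB.mixin Record CompleteNormedModule_isHilbert (R : realType) V
    of CompleteNormedModule R V & Vector R V := {
  inner : {dot V for idfun};
  sqr_norm_inner : forall x : V, `|x| ^+ 2 = inner x x
}.

#[short(type="finHilbertType")]
HB.structure Definition FinHilbert (R : realType) :=
  {V of CompleteNormedModule R V & Vector R V &
        CompleteNormedModule_isHilbert R V}.

Notation "''[' u , v ]" := (inner u%R v%R) : ring_scope.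

Section InnerTheory.
Context {R : realType} {X : finHilbertType R}.
Implicit Types x y z : X.

Lemma innerC x y : '[x, y] = '[y, x].
Proof. by rewrite hermC expr0 mul1r. Qed.

Lemma inner_eq0 x : ('[x, x] == 0) = (x == 0).
Proof. by rewrite -sqr_norm_inner sqrf_eq0 normr_eq0. Qed.

Lemma riesz (phi : {linear X -> R^o}) : exists v, forall x, phi x = '[x, v].
Proof.
pose T v : 'Hom(X, R^o) := linfun (applyr inner v : X -> R^o).
have Tlin : linear T.
  move=> a u v; apply/lfunP => x.
  by rewrite lfunE/= linearDr linearZr/= add_lfunE scale_lfunE !lfunE.
pose Tl : {linear X -> 'Hom(X, R^o)} :=
  HB.pack T (GRing.isLinear.Build _ _ _ _ T Tlin).
have ker0 : lker (linfun Tl) == 0%VS.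
  apply/lker0P => u v; rewrite !lfunE /= => /lfunP/(_ (u - v)).
  rewrite !lfunE/= => /eqP; rewrite -subr_eq0 -linearBr inner_eq0 subr_eq0.
  by move/eqP.
have : limg (linfun Tl) = fullv.
  apply/eqP; rewrite eqEdim subvf /= limg_dim_eq; last first.
    by rewrite (eqP ker0) capv0.
  by rewrite !dimvf /dim /= muln1.
move=> lT; have : linfun phi \in limg (linfun Tl) by rewrite lT memvf.
case/memv_imgP => v _ /lfunP vE; exists v => x.
by have := vE x; rewrite !lfunE.
Qed.

End InnerTheory.

Section Adjoint.
Context {R : realType} {X Y : finHilbertType R} (A : {linear X -> Y}).

Definition adjoint (y : Y) : X :=
  xget 0 [set v | forall x, '[A x, y] = '[x, v]].

Lemma adjointP x y : '[A x, y] = '[x, adjoint y].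
Proof.
pose g : X -> R^o := fun x => '[A x, y].
have glin : linear g.
  by move=> a u v; rewrite /g linearP linearDl linearZl_LR.
pose phi : {linear X -> R^o} := HB.pack g (GRing.isLinear.Build _ _ _ _ g glin).
have [v phiE] := riesz phi.
rewrite /adjoint; case: xgetP => [w _ -> //|/(_ v)].
by case.
Qed.

End Adjoint.

Section ConvexAnalysis.
Context {R : realType} {X : finHilbertType R}.
Implicit Types (f g : X -> \bar R) (x t : X) (E : set X).
Local Open Scope ereal_scope.

Definition edom f : set X := [set x | f x < +oo].

Definition eproper f := (forall x, -oo < f x) /\ edom f !=set0.

(* The open range 0 < t < 1 keeps the convention 0 * +oo = 0 out of the
   inequality. *)
Definition econvex f := forall x y (t : R), (0 < t < 1)%R ->
  f (t *: x + (1 - t) *: y)%R <= t%:E * f x + (1 - t)%:E * f y.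

Definition delta E x : \bar R := if x \in E then 0 else +oo.

Definition subdiff f x : set X :=
  [set v | forall y, f x + ('[y - x, v])%:E <= f y].

Definition SSR f g x :=
  (edom f `&` edom g) x /\
  subdiff (f \+ g) x = [set (u + v)%R | u in subdiff f x & v in subdiff g x].

Definition argmin f : set X := [set x | forall y, f x <= f y].

(* Set-valued, as an arg min; a singleton when f is proper, closed, convex. *)
Definition Prox f t : set X :=
  argmin (fun x => f x + (2^-1 * `|x - t| ^+ 2)%:E).

End ConvexAnalysis.

Section DualRepresentable.
Context {R : realType} {X Y : finHilbertType R}.

Definition dual_representable (lambda : R) (f : X -> \bar R)
    (A : {linear X -> Y}) (b : Y) (z : X) :=
  exists y : Y,
    [set A x - b | x in Prox (fun x => lambda%:E * f x)%E (z + adjoint A y)] 0.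

End DualRepresentable.

(* Main.v *)
From HB Require Import structures.
Require Import Defs.
From mathcomp Require Import all_boot all_order all_algebra.
From mathcomp Require Import all_classical all_reals all_analysis.
From mathcomp Require Import ring lra.

Set Implicit Arguments.
Unset Strict Implicit.
Unset Printing Implicit Defensive.

Import Order.TTheory GRing.Theory Num.Theory.
Import numFieldNormedType.Exports.

Local Open Scope classical_set_scope.
Local Open Scope ring_scope.

(** Write g for f plus the indicator of the affine set E.  The range of the
adjoint A^* is the orthogonal of the kernel of A, and is therefore the
subdifferential of the indicator at each point of E.  The sum rule at x then
says that every subgradient of g at x is a subgradient of f at x plus some
A^* y, the other inclusion being automatic.  This is the first equivalence.

The second rests on the description of the proximal map as a resolvent: x is
in Prox_(l f)(z) iff (z - x) / l is a subgradient of f at x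
([Prox_subdiffP]).  Dual representability at z hence means that some x in E
has, for some y, the subgradient (z + A^* y - x) / l of f.

If the sum rule holds, let x be the proximal point of z for g, which exists
because g is proper, closed and convex ([Prox_nonempty]).  The subgradient
(z - x) / l of g splits as a subgradient u of f plus an element of the range
of A^*, and u has exactly the form required.

Conversely, let v be a subgradient of g at x, and apply dual representability
at z = x + l v.  It gives a point x' of E and a y such that
(z + A^* y - x') / l is a subgradient of f at x'; removing A^* y / l gives the
subgradient (z - x') / l of g at x'.  Subdifferentials are monotone, and the
subgradients v at x and (z - x') / l at x' differ by - (x - x') / l, so
x' = x.  Therefore v + A^* y / l is a subgradient of f at x, which is the
decomposition of v. *)

(** * Inner product *)

Section Inner.
Context {R : realType} {X : finHilbertType R}.
Implicit Types (x y z : X) (a : R).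

Lemma innerDr x y z : '[x, y + z] = '[x, y] + '[x, z] :> R.
Proof. exact: linearDr. Qed.

Lemma innerZr a x y : '[x, a *: y] = a * '[x, y] :> R.
Proof. by rewrite linearZr. Qed.

Lemma innerNr x y : '[x, - y] = - '[x, y] :> R.
Proof. by rewrite -scaleN1r innerZr mulN1r. Qed.

Lemma innerDl x y z : '[x + y, z] = '[x, z] + '[y, z] :> R.
Proof. by rewrite innerC innerDr !(innerC z). Qed.

Lemma innerZl a x y : '[a *: x, y] = a * '[x, y] :> R.
Proof. by rewrite innerC innerZr (innerC y). Qed.

Lemma innerNl x y : '[- x, y] = - '[x, y] :> R.
Proof. by rewrite innerC innerNr (innerC y). Qed.

Definition innerE := (innerDl, innerDr, innerZl, innerZr, innerNl, innerNr).

Lemma sqr_normD x y : `|x + y| ^+ 2 = `|x| ^+ 2 + 2 * '[x, y] + `|y| ^+ 2.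
Proof. by rewrite !sqr_norm_inner !innerE (innerC y x); ring. Qed.

(** By polarization, continuity of the inner product is inherited from that of
the norm. *)
Lemma inner_continuous y : continuous (fun x => '[x, y] : R).
Proof.
have -> : (fun x => '[x, y] : R) =
    (fun x => 2^-1 * (`|x + y| ^+ 2 - `|x| ^+ 2 - `|y| ^+ 2)).
  by apply/funext => x; rewrite sqr_normD; field.
move=> x; apply: cvgM; first exact: cvg_cst.
apply: cvgB; last exact: cvg_cst.
by apply: cvgB; rewrite expr2; apply: cvgM; apply: cvg_norm => //;
  apply: cvgD => //; exact: cvg_cst.
Qed.
End Inner.

(** * Proper convex functions on their domain *)

(** On its domain a proper function is real-valued.  The lemmas ending in
[fineP] move statements about extended reals to that domain, where they become
linear arithmetic. *)
Section RealForm.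
Context {R : realType} {X : finHilbertType R}.
Implicit Types (x y z v : X) (g : X -> \bar R).

Lemma fineK_edom g x : eproper g -> edom g x -> g x = (fine (g x))%:E.
Proof. by move=> [g_gt _] gx; rewrite fineK// fin_numE -ltNye -ltey g_gt. Qed.

Lemma econvex_fineP g : eproper g ->
  econvex g <->
  forall x y (t : R), 0 < t < 1 -> edom g x -> edom g y ->
    edom g (t *: x + (1 - t) *: y) /\
    fine (g (t *: x + (1 - t) *: y)) <= t * fine (g x) + (1 - t) * fine (g y).
Proof.
move=> gP; split=> [gC x y t t01 gx gy | gC x y t t01].
  have := gC x y t t01.
  rewrite (fineK_edom gP gx) (fineK_edom gP gy) /= -!EFinM -EFinD => le.
  have d : edom g (t *: x + (1 - t) *: y) by apply: le_lt_trans le (ltry _).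
  by split=> //; move: le; rewrite (fineK_edom gP d) lee_fin.
have [g_gt _] := gP.
have /andP[t0 t1] := t01.
have s0 : 0 < 1 - t by rewrite subr_gt0.
have mul_gt (a : R) u : 0 < a -> (-oo < a%:E * g u)%E.
  move=> a0; case: (g u) (g_gt u) => [r| |] //= _.
    by rewrite -EFinM ltNyr.
  by rewrite gt0_muley// lte_fin.
have [gx|] := ltP (g x) +oo%E; last first.
  rewrite leye_eq => /eqP ->.
  by rewrite gt0_muley ?lte_fin// addye ?leey// gt_eqF// mul_gt.
have [gy|] := ltP (g y) +oo%E; last first.
  rewrite leye_eq => /eqP ->.
  by rewrite gt0_muley ?lte_fin// addey ?leey// gt_eqF// mul_gt.
have [d le] := gC x y t t01 gx gy.
by rewrite (fineK_edom gP d) (fineK_edom gP gx) (fineK_edom gP gy)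
  -!EFinM -EFinD lee_fin.
Qed.

Lemma subdiff_fineP g x v : eproper g ->
  subdiff g x v <->
  edom g x /\ forall y, edom g y -> fine (g x) + '[y - x, v] <= fine (g y).
Proof.
move=> gP; split=> [gxv|[gx gxv] y].
  have gx : edom g x.
    have [_ [w gw]] := gP; have := le_lt_trans (gxv w) gw.
    rewrite /edom /=; case: (g x) => [r| |] //= _; exact: ltry.
  split=> // y gy; have := gxv y.
  by rewrite (fineK_edom gP gx) (fineK_edom gP gy) -EFinD lee_fin.
have [gy|] := ltP (g y) +oo%E; last by rewrite leye_eq => /eqP ->; rewrite leey.
rewrite (fineK_edom gP gx) (fineK_edom gP gy) -EFinD lee_fin; exact: gxv.
Qed.

Lemma Prox_fineP (l : R) g z x : 0 < l -> eproper g ->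
  Prox (fun u => l%:E * g u)%E z x <->
  edom g x /\ forall y, edom g y ->
    l * fine (g x) + 2^-1 * `|x - z| ^+ 2 <= l * fine (g y) + 2^-1 * `|y - z| ^+ 2.
Proof.
move=> l0 gP; rewrite /Prox /argmin /=; split=> [xP|[gx xP] y].
  have gx : edom g x.
    have [_ [w gw]] := gP; have := xP w.
    rewrite (fineK_edom gP gw) -EFinM -EFinD => /le_lt_trans/(_ (ltry _)).
    have := gP.1 x; rewrite /edom /=; case: (g x) => [r| |] // _.
    by rewrite gt0_muley ?lte_fin// addye.
  split=> // y gy; have := xP y.
  by rewrite (fineK_edom gP gx) (fineK_edom gP gy) -!EFinM -!EFinD lee_fin.
have [gy|] := ltP (g y) +oo%E; last first.
  by rewrite leye_eq => /eqP ->; rewrite gt0_muley ?lte_fin// addye ?leey.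
rewrite (fineK_edom gP gx) (fineK_edom gP gy) -!EFinM -!EFinD lee_fin.
exact: xP.
Qed.

(** * Proximal points *)

Lemma subdiff_monotone g x y u v : eproper g ->
  subdiff g x u -> subdiff g y v -> (0 : R) <= '[x - y, u - v].
Proof.
move=> gP /(subdiff_fineP _ _ gP)[gx xu] /(subdiff_fineP _ _ gP)[gy yv].
have := xu _ gy; have := yv _ gx; rewrite !innerE; lra.
Qed.

(** Fermat's rule for the proximal objective.  A subgradient inequality gives
optimality after expanding the squares.  Conversely, optimality of x against
the points of the segment from x to y gives the subgradient inequality up to
an error proportional to s, the relative position on the segment, and s tends
to 0. *)
Lemma Prox_subdiffP (l : R) g z x : 0 < l -> eproper g -> econvex g ->
  Prox (fun u => l%:E * g u)%E z x <-> subdiff g x (l^-1 *: (z - x)).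
Proof.
move=> l0 gP /(econvex_fineP gP) gC.
split=> [/(Prox_fineP _ _ l0 gP)|/(subdiff_fineP _ _ gP)] [gx xP]; last first.
  apply/(Prox_fineP _ _ l0 gP); split=> // y gy.
  have := xP y gy; rewrite innerZr -(ler_pM2l l0) mulrDr mulVKf ?gt_eqF//.
  have : (0 : R) <= `|y - x| ^+ 2 by exact: sqr_ge0.
  rewrite !sqr_norm_inner !innerE (innerC y x) (innerC z x) (innerC z y); lra.
apply/(subdiff_fineP _ _ gP); split=> // y gy.
rewrite innerZr -(ler_pM2l l0) mulrDr mulVKf ?gt_eqF//.
set N := 2^-1 * `|y - x| ^+ 2 : R.
have N0 : 0 <= N by rewrite mulr_ge0// ?sqr_ge0// invr_ge0.
have main (s : R) : 0 < s < 1 ->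
    l * fine (g x) + '[y - x, z - x] <= l * fine (g y) + s * N.
  move=> s01; have [d le] := gC y x s s01 gy gx.
  have /andP[s0 s1] := s01.
  have := xP _ d.
  have -> : s *: y + (1 - s) *: x - z = (x - z) + s *: (y - x).
    by rewrite scalerBl scale1r scalerBr addrCA addrAC.
  rewrite (sqr_normD (x - z)) normrZ exprMn gtr0_norm//.
  have : l * fine (g (s *: y + (1 - s) *: x)) <=
         l * (s * fine (g y) + (1 - s) * fine (g x)) by rewrite ler_pM2l.
  rewrite /N !innerE (innerC x y) (innerC z y) (innerC z x) => h1 h2.
  by rewrite -(ler_pM2l s0); lra.
(* The error s * N is at most e for this s; N may vanish, hence N + 1. *)
apply/ler_addgt0Pr => e e0; pose s := Num.min 2^-1 (e / (N + 1)).
have N1 : 0 < N + 1 by lra.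
have s0 : 0 < s by rewrite lt_min divr_gt0//; lra.
have s1 : s <= 2^-1 by rewrite ge_min lexx.
have sN : s * (N + 1) <= e by rewrite -ler_pdivlMr// ge_min lexx orbT.
have := main s; rewrite s0 /= => /(_ _)/le_trans; apply; lra.
Qed.

(** Semicontinuity bounds g below near x0, by g x0 - 1 on a ball of radius r.
Too low a value of g far away would, by convexity along the segment to x0, force
a value below g x0 - 1 inside the ball; so g decreases at most linearly. *)
Lemma econvex_ge g x0 : eproper g -> lower_semicontinuous g -> econvex g ->
  edom g x0 -> exists c : R, exists2 C : R, 0 <= C &
    forall x, edom g x -> c - C * `|x - x0| <= fine (g x).
Proof.
move=> gP gL /(econvex_fineP gP) gC gx0.
have [|V /nbhs_ballP[r /= r0 rV] Vg] := gL x0 (fine (g x0) - 1).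
  by rewrite (fineK_edom gP gx0) lte_fin/=; lra.
have near_x0 y : edom g y -> `|y - x0| < r -> fine (g x0) - 1 < fine (g y).
  move=> gy yr; have : V y by apply: rV; rewrite -ball_normE /= distrC.
  by move/Vg; rewrite (fineK_edom gP gy) lte_fin.
exists (fine (g x0) - 1); exists (2 / r); first by rewrite divr_ge0// ltW.
move=> x gx; set d := `|x - x0|.
have d0 : 0 <= d by exact: normr_ge0.
have rd0 : 0 <= 2 / r * d by rewrite mulr_ge0// divr_ge0// ltW.
have [dr|rd] := ltP d r; first by have := near_x0 x gx dr; lra.
have d_gt0 : 0 < d by exact: lt_le_trans rd.
(* The point at distance r / 2 from x0 on the segment towards x. *)
pose t := r / (2 * d).
have td : t * d = r / 2 by rewrite /t; field; rewrite gt_eqF.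
have t0 : 0 < t by rewrite divr_gt0// mulr_gt0.
have t1 : t < 1 by rewrite -(ltr_pM2r d_gt0) td; lra.
have [|dt le] := gC x x0 t _ gx gx0; first by rewrite t0.
have := near_x0 _ dt.
have -> : t *: x + (1 - t) *: x0 - x0 = t *: (x - x0).
  by rewrite scalerBl scale1r scalerBr addrA addrAC addrK.
rewrite normrZ gtr0_norm// -/d td => /(_ _)lt.
have : t * (fine (g x0) - 2 / r * d) <= t * fine (g x).
  have -> : t * (fine (g x0) - 2 / r * d) =
            t * fine (g x0) - 2 / r * (t * d) by ring.
  by rewrite td mulrA divfK ?gt_eqF// mulfV//; have := lt _; lra.
by rewrite ler_pM2l//; lra.
Qed.

(** The direct method, compactness being replaced by strong convexity.  The
objective h is bounded below because its quadratic term dominates the linear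
decrease of g.  Comparing h at two almost minimal points with h at their
midpoint shows that they are close, so minimizing sequences are Cauchy, and the
limit is a minimizer by semicontinuity. *)
Lemma Prox_nonempty (l : R) g z : 0 < l ->
  eproper g -> lower_semicontinuous g -> econvex g ->
  Prox (fun u => l%:E * g u)%E z !=set0.
Proof.
move=> l0 gP gL gC; have [_ [x0 gx0]] := gP.
have [c [C C0 gge]] := econvex_ge gP gL gC gx0.
pose h y : R := l * fine (g y) + 2^-1 * `|y - z| ^+ 2.
pose S := [set h y | y in edom g].
have Slb : has_lbound S.
  (* The minimum over the reals a of a ^+ 2 / 2 - l * C * a is
     - (l * C) ^+ 2 / 2, here with a the distance from y to z. *)
  exists (l * c - l * C * `|z - x0| - 2^-1 * (l * C) ^+ 2) => _ [y gy <-].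
  rewrite /h; have := gge y gy; rewrite -(ler_pM2l l0).
  have : l * C * `|y - x0| <= l * C * (`|y - z| + `|z - x0|).
    by rewrite ler_wpM2l ?ler_distD// mulr_ge0// ltW.
  have := sqr_ge0 (`|y - z| - l * C); lra.
have Sinf : has_inf S by split=> //; exists (h x0), x0.
set m := inf S.
have m_le y : edom g y -> m <= h y by move=> gy; apply: ge_inf => //; exists y.
have /choice[u uP] (n : nat) : exists y, edom g y /\ h y < m + n.+1%:R^-1.
  by have [|_ [y gy <-] lt] := inf_adherent _ Sinf (eps := n.+1%:R^-1);
    [rewrite invr_gt0|exists y].
have u_dist i j : `|u i - u j| ^+ 2 <= 4 * (i.+1%:R^-1 + j.+1%:R^-1).
  have [gi hi] := uP i; have [gj hj] := uP j.
  have [|d] := (econvex_fineP gP).1 gC _ _ 2^-1 _ gi gj.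
    by apply/andP; split; lra.
  rewrite -(ler_pM2l l0) => le; have := m_le _ d; move: hi hj; rewrite /h.
  have -> : u i - u j = (u i - z) + (- (u j - z)) by rewrite opprB addrA subrK.
  have -> : 2^-1 *: u i + (1 - 2^-1) *: u j - z =
            2^-1 *: (u i - z) + 2^-1 *: (u j - z).
    have -> : 1 - 2^-1 = 2^-1 :> R by field.
    rewrite !scalerBr addrACA -opprD -scalerDl.
    by have -> : 2^-1 + 2^-1 = 1 :> R; [field|rewrite scale1r].
  rewrite (sqr_normD (u i - z)) (sqr_normD (_ *: _)) !normrZ normrN.
  rewrite !innerE gtr0_norm ?invr_gt0// !exprMn.
  move: le; move: (fine _) (fine _) (fine _) => F1 F2 F3.
  move: i.+1%:R^-1 j.+1%:R^-1 => ei ej; lra.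
have : cvg (u @ \oo).
  apply: cauchy_cvg; apply: cauchy_exP => e e0.
  have [N _ NP] : \forall n \near \oo, n.+1%:R^-1 < e ^+ 2 / 8 :> R.
    have e8 : 0 < e ^+ 2 / 8 by rewrite divr_gt0// exprn_gt0.
    by have /cvgr_lt/(_ _ e8) := @cvg_harmonic R.
  exists (u N); exists N => // n /= Nn; rewrite -ball_normE /=.
  rewrite -(@ltr_pXn2r _ 2) ?nnegrE ?(ltW e0)//.
  apply: le_lt_trans (u_dist _ _) _.
  by have := NP N (leqnn _); have := NP n Nn; move=> /=;
    move: N.+1%:R^-1 n.+1%:R^-1 => eN en; lra.
move=> /cvg_ex[x ux]; exists x.
(* This bound also yields that the limit x lies in the domain of g. *)
suff gx_le : (g x <= (l^-1 * (m - 2^-1 * `|x - z| ^+ 2))%:E)%E.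
  have gx : edom g x by exact: le_lt_trans gx_le (ltry _).
  apply/(Prox_fineP _ _ l0 gP); split=> // y gy; apply: le_trans (m_le y gy).
  by move: gx_le; rewrite (fineK_edom gP gx) lee_fin ler_pdivlMl// lerBrDr.
rewrite leNgt; apply/negP.
set a0 := l^-1 * _ => a0g.
(* Otherwise g exceeds some a > a0 near x, hence along the tail of u, where h
   then stays away from its infimum m. *)
have [a [a0a ag]] : exists a, a0 < a /\ (a%:E < g x)%E.
  case: (g x) a0g => [r| |]; rewrite ?lte_fin.
  - by move=> lt; exists ((a0 + r) / 2); rewrite lte_fin; split; lra.
  - by exists (a0 + 1); rewrite ltry; split => //; lra.
  - by [].
have [V xV Vg] := gL x a ag.
have cv : l * a + 2^-1 * `|u n - z| ^+ 2 - n.+1%:R^-1 @[n --> \oo] -->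
          l * a + 2^-1 * `|x - z| ^+ 2 - 0.
  apply: cvgB; last exact: cvg_harmonic.
  apply: cvgD; first exact: cvg_cst.
  apply: cvgM; first exact: cvg_cst.
  by rewrite expr2; apply: cvgM; apply: cvg_norm; apply: cvgB => //;
    exact: cvg_cst.
have m_lt : m < l * a + 2^-1 * `|x - z| ^+ 2 - 0.
  by move: a0a; rewrite /a0 ltr_pdivrMl//; lra.
have := ux _ xV; move/cvgr_gt : cv => /(_ _ m_lt) c1 c2.
have [N _ /(_ N (leqnn _)) [/= lt1 Vu]] := filterI c1 c2.
have [gu hu] := uP N; have := Vg _ Vu; rewrite (fineK_edom gP gu) lte_fin.
by rewrite -(ltr_pM2l l0); move: hu; rewrite /h; move: lt1;
  move: N.+1%:R^-1 => eN; lra.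
Qed.

End RealForm.

(** * Affine constraints *)

Section AffineConstraint.
Context {R : realType} {X Y : finHilbertType R} (A : {linear X -> Y}) (b : Y).
Implicit Types (f : X -> \bar R) (x z v : X) (y : Y).

Local Notation E := [set x | A x = b].

(** A vector v orthogonal to the kernel of A induces, along any section s of
the surjection A, a linear form w |-> <s w, v> on Y; the vector representing it
is a preimage of v under the adjoint. *)
Lemma range_adjointP v : range A = [set: Y] ->
  range (adjoint A) v <-> forall x, A x = 0 -> '[x, v] = 0 :> R.
Proof.
move=> Asurj; split=> [[y _ <-] x Ax0|vker].
  by rewrite -adjointP Ax0 -(scale0r (0 : Y)) innerZl mul0r.
have /choice[s sK] (w : Y) : exists x, A x = w.
  by have [x _ Ax] : range A w; [rewrite Asurj|exists x].
pose psi w : R^o := '[s w, v].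
have psi_lin : linear psi.
  move=> a w1 w2; have /vker : A (s (a *: w1 + w2) - (a *: s w1 + s w2)) = 0.
    by rewrite linearB linearP !sK subrr.
  by rewrite !innerE => /eqP; rewrite subr_eq0 => /eqP.
pose psiL : {linear Y -> R^o} :=
  HB.pack psi (GRing.isLinear.Build _ _ _ _ psi psi_lin).
have [y psiE] := riesz psiL; exists y => //.
apply/eqP; rewrite -subr_eq0 -inner_eq0; set u := adjoint A y - v.
rewrite {2}/u innerDr innerNr -adjointP -psiE /= /psi -innerNl -innerDl vker//.
by rewrite linearB sK subrr.
Qed.

Lemma delta_in (S : set X) x : S x -> delta S x = 0%E :> \bar R.
Proof. by move=> Sx; rewrite /delta mem_set. Qed.

Lemma delta_notin (S : set X) x : ~ S x -> delta S x = +oo%E :> \bar R.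
Proof. by move=> nSx; rewrite /delta memNset. Qed.

(** The differences of points of E form the kernel of A, a subspace, so the
inequality defining a normal vector applies to a direction and to its opposite
and is an equality. *)
Lemma subdiff_delta_affine x : range A = [set: Y] -> E x ->
  subdiff (delta E) x = range (adjoint A).
Proof.
move=> Asurj Ex; apply/seteqP; split=> v; last first.
  move/(range_adjointP _ Asurj) => vker y; rewrite (delta_in Ex) add0e.
  have [Ey|nEy] := pselect (E y); last by rewrite delta_notin ?leey.
  by rewrite (delta_in Ey) lee_fin vker// linearB Ex Ey subrr.
move=> vP; apply/(range_adjointP _ Asurj) => w Aw.
have le0 w' : A w' = 0 -> '[w', v] <= 0 :> R.
  move=> Aw'; have Exw : E (x + w') by rewrite /= linearD Aw' addr0.
  by have := vP (x + w'); rewrite !delta_in// add0e lee_fin addrAC subrr add0r.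
apply/eqP; rewrite eq_le le0//= -oppr_le0 -innerNl le0//.
by rewrite linearN Aw oppr0.
Qed.

Lemma add_delta_in f x : E x -> (f \+ delta E)%E x = f x.
Proof. by move=> Ex; rewrite /= delta_in// adde0. Qed.

Lemma edom_add_delta f x : eproper f ->
  edom (f \+ delta E)%E x <-> E x /\ edom f x.
Proof.
move=> fP; rewrite /edom /=; split=> [|[Ex fx]]; last by rewrite delta_in// adde0.
have [Ex|nEx] := pselect (E x); first by rewrite delta_in// adde0.
by rewrite delta_notin// addey// gt_eqF// fP.1.
Qed.

Lemma eproper_add_delta f : eproper f -> E `&` edom f !=set0 ->
  eproper (f \+ delta E)%E.
Proof.
move=> fP [x0 Fx0]; split; last by exists x0; exact/edom_add_delta.
move=> x; have [Ex|nEx] := pselect (E x); first by rewrite add_delta_in ?fP.1.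
by rewrite /= delta_notin// addey ?ltNy0// gt_eqF// fP.1.
Qed.

Lemma econvex_add_delta f : eproper f -> E `&` edom f !=set0 ->
  econvex f -> econvex (f \+ delta E)%E.
Proof.
move=> fP F0 /(econvex_fineP fP) fC.
apply/(econvex_fineP (eproper_add_delta fP F0)) => x y t t01.
move=> /(edom_add_delta _ fP)[Ex fx] /(edom_add_delta _ fP)[Ey fy].
have [d le] := fC x y t t01 fx fy.
have Ed : E (t *: x + (1 - t) *: y).
  by rewrite /= linearD !linearZ /= Ex Ey -scalerDl addrC subrK scale1r.
by split; [exact/edom_add_delta|rewrite !add_delta_in].
Qed.

(** What has to be seen is that E is closed.  A point x outside E is separated
from E by the continuous function y |-> <A y - b, A x - b>, which is positive
at x and zero on E; it is continuous because A moves to the other side of the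
inner product as its adjoint. *)
Lemma lsc_add_delta f : eproper f -> lower_semicontinuous f ->
  lower_semicontinuous (f \+ delta E)%E.
Proof.
move=> fP fL x a.
have out (y : X) : ~ E y -> (f \+ delta E)%E y = +oo%E.
  by move=> nEy; rewrite /= delta_notin// addey// gt_eqF// fP.1.
have [Ex|nEx] := pselect (E x).
  rewrite add_delta_in// => /fL[V xV Vf]; exists V => // y Vy.
  have [Ey|nEy] := pselect (E y); first by rewrite add_delta_in ?Vf.
  by rewrite out// ltry.
move=> _; pose w := A x - b.
have w_gt0 : '[b, w] < '[x, adjoint A w] :> R.
  rewrite -adjointP -subr_gt0 -innerNl -innerDl -sqr_norm_inner exprn_gt0//.
  by rewrite normr_gt0 subr_eq0; apply/eqP.
have /cvgr_gt/(_ _ w_gt0) near_x := @inner_continuous _ X (adjoint A w) x.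
exists [set y | '[b, w] < '[y, adjoint A w] :> R] => // y /=.
by rewrite -adjointP => lt; rewrite out ?ltry// => Ey; rewrite Ey ltxx in lt.
Qed.

Lemma subdiff_add_delta_sub f x : eproper f -> range A = [set: Y] -> E x ->
  [set u + v | u in subdiff f x & v in range (adjoint A)] `<=`
  subdiff (f \+ delta E)%E x.
Proof.
move=> fP Asurj Ex _ [u fu [v rv <-]] y; move: rv.
rewrite -(subdiff_delta_affine Asurj Ex) => Ev.
rewrite innerDr EFinD addeACA; apply: leeD; [exact: fu|exact: Ev].
Qed.

Lemma SSR_affineP f x : range A = [set: Y] -> (E `&` edom f) x ->
  SSR f (delta E) x <-> subdiff (f \+ delta E)%E x =
      [set u + v | u in subdiff f x & v in range (adjoint A)].
Proof.
move=> Asurj [Ex fx]; rewrite /SSR subdiff_delta_affine//; split=> [[]//|eq].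
by split=> //; split=> //; rewrite /edom /= delta_in// ltry.
Qed.

Lemma dual_representableP (l : R) f z : 0 < l -> eproper f -> econvex f ->
  dual_representable l f A b z <->
  exists x y, E x /\ subdiff f x (l^-1 *: (z + adjoint A y - x)).
Proof.
move=> l0 fP fC; split=> [[y [x xP /eqP]]|[x [y [Ex xP]]]].
  rewrite subr_eq0 => /eqP Ex; exists x, y; split=> //.
  exact/Prox_subdiffP.
by exists y; exists x; [exact/Prox_subdiffP|rewrite Ex subrr].
Qed.

End AffineConstraint.

Theorem theorem1 (R : realType) (X Y : finHilbertType R)
    (lambda : R) (b : Y) (f : X -> \bar R) (A : {linear X -> Y})
    (E := [set x | A x = b]) (F := E `&` edom f) :
  0 < lambda ->
  eproper f -> lower_semicontinuous f -> econvex f ->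
  range A = [set: Y] ->
  F !=set0 ->
  ((forall x, F x -> SSR f (delta E) x) <->
   (forall x, F x -> subdiff (f \+ delta E)%E x =
      [set u + v | u in subdiff f x & v in range (adjoint A)])) /\
  ((forall x, F x -> SSR f (delta E) x) <->
   (forall z, dual_representable lambda f A b z)).
Proof.
move=> l0 fP fL fC Asurj F0.
have ssr : (forall x, F x -> SSR f (delta E) x) <->
   (forall x, F x -> subdiff (f \+ delta E)%E x =
      [set u + v | u in subdiff f x & v in range (adjoint A)]).
  by split=> H x Fx; apply/(SSR_affineP Asurj Fx); exact: H.
split=> //; rewrite ssr {ssr}.
have gP : eproper (f \+ delta E)%E by exact: eproper_add_delta.
have gC : econvex (f \+ delta E)%E by exact: econvex_add_delta.
have gL : lower_semicontinuous (f \+ delta E)%E by exact: lsc_add_delta.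
have range_adjZ a y : range (adjoint A) y -> range (adjoint A) (a *: y).
  move=> /(range_adjointP _ Asurj) y0; apply/(range_adjointP _ Asurj) => x Ax0.
  by rewrite innerZr y0// mulr0.
split=> [sumF z | dual x Fx].
  (* z - x = lambda (u + v) with v in the range of the adjoint, so the
     multiplier y has to satisfy A^* y = - lambda v. *)
  have [x /(Prox_subdiffP _ _ l0 gP gC) xz] := Prox_nonempty z l0 gP gL gC.
  have [/(edom_add_delta A b _ fP) Fx _] := (subdiff_fineP _ _ gP).1 xz.
  move: (xz); rewrite sumF// => -[u fu [v rv uv]].
  have [y _ yv] := range_adjZ (- lambda) _ rv.
  apply/dual_representableP => //; exists x, y; split; first exact: Fx.1.
  suff -> : lambda^-1 *: (z + adjoint A y - x) = u by [].
  by rewrite yv addrAC scalerDr -uv scaleNr scalerN scalerK ?gt_eqF// addrK.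
apply/seteqP; split; last exact: subdiff_add_delta_sub Fx.1.
(* x + lambda v is the point whose proximal point for f + delta E is x. *)
move=> v xv.
have [x' [y [Ex' x'v]]] :=
  (dual_representableP A b _ l0 fP fC).1 (dual (x + lambda *: v)).
have ry a : range (adjoint A) (a *: adjoint A y).
  by apply: range_adjZ; exists y.
have x'g : subdiff (f \+ delta E)%E x' (lambda^-1 *: (x + lambda *: v - x')).
  apply: subdiff_add_delta_sub => //.
  exists (lambda^-1 *: (x + lambda *: v + adjoint A y - x')) => //.
  exists (- lambda^-1 *: adjoint A y); first exact: ry.
  by rewrite scaleNr -scalerBr addrAC addrK.
have x'x : x' = x.
  have := subdiff_monotone gP xv x'g.
  have -> : v - lambda^-1 *: (x + lambda *: v - x') = - (lambda^-1 *: (x - x')).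
    by rewrite addrAC scalerDr scalerK ?gt_eqF// opprD addrCA subrr addr0.
  rewrite innerNr innerZr -sqr_norm_inner oppr_ge0 pmulr_rle0 ?invr_gt0//.
  rewrite le_eqVlt ltNge sqr_ge0 orbF sqrf_eq0 normr_eq0 subr_eq0.
  by move/eqP.
rewrite x'x in x'v.
exists (lambda^-1 *: (x + lambda *: v + adjoint A y - x)) => //.
exists (- lambda^-1 *: adjoint A y); first exact: ry.
by rewrite scaleNr -scalerBr addrAC addrK addrAC subrr add0r scalerK ?gt_eqF.
Qed.
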